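(* Let $\mathcal{V}$ be a vector space over a field $\mathbb{F}$ and let $P:\mathcal{V}\to\mathcal{V}$ be a linear operator with a factorisation $P=P_0P_1\cdots P_\ell$ that is a decomposition of $P$, with associated operators $Q_0,\ldots,Q_\ell$. Fix $f\in\mathcal{V}$. There is a 1-1 relationship between solutions $u\in\mathcal{V}$ of $Pu=f$ and solutions $(u_0,\ldots,u_\ell)\in\bigoplus^{\ell+1}\mathcal{V}$ of the problem $$P_0u_0=f,\ \ldots,\ P_\ell u_\ell=f.$$ More precisely, write $\mathcal{V}_P^f$ for the solution space of $Pu=f$ and $\mathcal{V}_i^f$ for the solution space of $P_i\tilde u=f$, $i=0,\ldots,\ell$. The map $F:\mathcal{V}_P^f\to\times_{i=0}^{\ell}\mathcal{V}_i^f$ is given by $$u\mapsto(P^0u,\ldots,P^\ell u),$$ with inverse $B:\times_{i=0}^{\ell}\mathcal{V}_i^f\to\mathcal{V}_P^f$ given by $$(u_0,\ldots,u_\ell)\mapsto\sum_{i=0}^{\ell}Q_iu_i.$$ On $\mathcal{V}$ (with $F$ and $B$ given by the same formulae) we have $B\circ F=\mathrm{id}_{\mathcal{V}}$, while on the affine space $\times_{i=0}^{\ell}\mathcal{V}_i^f$ we have $F\circ B=\mathrm{id}$.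
   Context: Definition (decomposition): for a linear operator $P:\mathcal{V}\to\mathcal{V}$, an expression $P=P_0P_1\cdots P_\ell$ as a composition of linear operators $P_i:\mathcal{V}\to\mathcal{V}$ is a decomposition of $P$ if $\ell\ge1$ and there exist linear operators $Q_i:\mathcal{V}\to\mathcal{V}$, $i=0,\ldots,\ell$, with $$\mathrm{id}_{\mathcal{V}}=Q_0P^0+\cdots+Q_\ell P^\ell,\qquad P^i:=\prod_{j\ne i,\,0\le j\le\ell}P_j,$$ and $P_iP_j=P_jP_i$, $P_iQ_j=Q_jP_i$ for all $i,j\in\{0,\ldots,\ell\}$. *)

(* Defs.v *)
From HB Require Import structures.
From mathcomp Require Import all_boot all_algebra.
From mathcomp Require Import classical_sets functions.

Set Implicit Arguments.
Unset Strict Implicit.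
Unset Printing Implicit Defensive.

Import GRing.Theory.
Local Open Scope ring_scope.
Local Open Scope classical_set_scope.

Section Decomposition.
Variables (K : fieldType) (V : lmodType K) (l : nat).
Implicit Types (P : {linear V -> V}) (Ps Qs : 'I_l.+1 -> {linear V -> V}).

Definition prod_op Ps : V -> V := \big[@comp V V V/idfun]_(j < l.+1) Ps j.

(* Written P^i in informal notation: an upper index, not a power. *)
Definition prod_op_but Ps (i : 'I_l.+1) : V -> V :=
  \big[@comp V V V/idfun]_(j < l.+1 | j != i) Ps j.

(* P = P_0 ... P_l is a decomposition of P when some Qs satisfies this. *)
Definition decomposition_with P Ps Qs : Prop :=
  [/\ (1 <= l)%N,
      P =1 prod_op Ps,
      forall v, v = \sum_(i < l.+1) Qs i (prod_op_but Ps i v),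
      forall i j, Ps i \o Ps j =1 Ps j \o Ps i
    & forall i j, Ps i \o Qs j =1 Qs j \o Ps i].

(* The sets of solutions are affine subspaces, possibly empty. *)
Definition sol P (f : V) : set V := [set u | P u = f].

Definition sol_prod Ps (f : V) : set {ffun 'I_l.+1 -> V} :=
  [set us | forall i, sol (Ps i) f (us i)].

Definition Fmap Ps (u : V) : {ffun 'I_l.+1 -> V} :=
  [ffun i => prod_op_but Ps i u].

Definition Bmap Qs (us : {ffun 'I_l.+1 -> V}) : V :=
  \sum_(i < l.+1) Qs i (us i).

End Decomposition.

(* Main.v *)
Require Import Defs.
From HB Require Import structures.
From mathcomp Require Import all_boot all_algebra.
From mathcomp Require Import classical_sets functions.

(** Write P^i for the product of all the P_j with j <> i. As the P_j commute,
    P = P_i P^i, so P^i sends a solution of P u = f to a solution of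
    P_i v = f, and [B (F u) = \sum_i Q_i (P^i u) = u] is the partition of
    identity given by the decomposition.

    The point is the other composite. Let P_j u_j = f for every j, and for
    i <> j let P^ij be the product of all the factors but P_i and P_j. Then
    P^i u_j = P^ij P_j u_j = P^ij f = P^ij P_i u_i = P^j u_i
    (lemma [prod_op_but_swap]): the family may exchange its two indices.
    Since the Q_j commute with P^i, the i-th component of F (B us) is
    \sum_j Q_j (P^i u_j) = \sum_j Q_j (P^j u_i) = u_i, again by the partition
    of identity. Finally P (B us) = P_0 (P^0 (B us)) = P_0 u_0 = f, so B does
    land in the solutions of P u = f. *)

Set Implicit Arguments.
Unset Strict Implicit.
Unset Printing Implicit Defensive.

Import GRing.Theory.
Local Open Scope ring_scope.
Local Open Scope classical_set_scope.

Lemma big_comp_commute (I T : Type) (r : seq I) (p : pred I)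
    (F : I -> T -> T) (g : T -> T) :
    (forall j, g \o F j =1 F j \o g) ->
  g \o \big[comp/idfun]_(j <- r | p j) F j
    =1 \big[comp/idfun]_(j <- r | p j) F j \o g.
Proof.
move=> gF; elim/big_rec: _ => // j h _ IH v /=.
by rewrite [LHS]gF /= [g (h v)]IH.
Qed.

(** Composition is not a commutative law, so that [bigD1] does not apply: the
    factor [F i] has to be moved across those that precede it. It is put
    innermost, next to the argument. *)
Lemma big_comp_rem (I : eqType) (T : Type) (r : seq I) (p : pred I)
    (F : I -> T -> T) (i : I) :
    (forall j k, F j \o F k =1 F k \o F j) -> uniq r -> i \in r -> p i ->
  \big[comp/idfun]_(j <- r | p j) F j
    =1 \big[comp/idfun]_(j <- r | p j && (j != i)) F j \o F i.
Proof.
move=> FC; elim: r => // a r IH /= /andP[a_r r_uniq] i_ar pi v.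
rewrite !big_cons; have [a_i|a_i] := eqVneq a i.
  rewrite a_i pi /= [LHS](big_comp_commute r p (FC i)) /=.
  congr (_ (F i v)); rewrite big_seq_cond [RHS]big_seq_cond.
  apply: eq_bigl => j; have [->|_] := eqVneq j i; last by rewrite andbT.
  by rewrite -a_i (negbTE a_r).
have i_r : i \in r by move: i_ar; rewrite inE eq_sym (negbTE a_i).
by rewrite andbT; case: (p a); rewrite /= (IH r_uniq i_r pi).
Qed.

Lemma big_comp_sum (I J : Type) (U : zmodType) (r : seq I) (p : pred I)
    (F : I -> {additive U -> U}) (s : seq J) (us : J -> U) :
  (\big[comp/idfun]_(i <- r | p i) (F i : U -> U)) (\sum_(j <- s) us j)
    = \sum_(j <- s) (\big[comp/idfun]_(i <- r | p i) (F i : U -> U)) (us j).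
Proof. by elim/big_rec: _ => // i h _ IH /=; rewrite IH raddf_sum. Qed.

Section CommutingFactors.
Variables (K : fieldType) (V : lmodType K) (l : nat).
Variable Ps : 'I_l.+1 -> {linear V -> V}.
Hypothesis PsC : forall i j, Ps i \o Ps j =1 Ps j \o Ps i.

Lemma prod_op_rem i : prod_op Ps =1 Ps i \o prod_op_but Ps i.
Proof.
move=> v; rewrite [RHS](big_comp_commute _ _ (PsC i)).
by rewrite [LHS](big_comp_rem PsC (index_enum_uniq _) (mem_index_enum i)).
Qed.

(** For i <> j both sides are the product of the other factors, applied
    to the common value f = P_j u_j = P_i u_i. *)
Lemma prod_op_but_swap f (us : {ffun 'I_l.+1 -> V}) i j :
  sol_prod Ps f us -> prod_op_but Ps i (us j) = prod_op_but Ps j (us i).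
Proof.
move=> us_sol; have [->//|ij] := eqVneq i j; have ji := ij.
rewrite eq_sym in ji; have [mi mj] := (mem_index_enum i, mem_index_enum j).
rewrite [LHS](big_comp_rem PsC (index_enum_uniq _) mj ji) /= (us_sol j).
rewrite [RHS](big_comp_rem PsC (index_enum_uniq _) mi ij) /= (us_sol i).
by congr (_ f); apply: eq_bigl => k; rewrite andbC.
Qed.

End CommutingFactors.

Theorem theorem2p2 (K : fieldType) (V : lmodType K) (l : nat)
    (P : {linear V -> V}) (Ps Qs : 'I_l.+1 -> {linear V -> V}) (f : V)
    (decP : decomposition_with P Ps Qs) :
  [/\ set_bij (sol P f) (sol_prod Ps f) (Fmap Ps),
      set_bij (sol_prod Ps f) (sol P f) (Bmap Qs),
      forall u : V, Bmap Qs (Fmap Ps u) = u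
    & forall us : {ffun 'I_l.+1 -> V},
        sol_prod Ps f us -> Fmap Ps (Bmap Qs us) = us].
Proof.
have [_ PE idE PsC PQC] := decP.
have BF u : Bmap Qs (Fmap Ps u) = u.
  by rewrite [RHS]idE; apply: eq_bigr => i _; rewrite ffunE.
have FB us : sol_prod Ps f us -> Fmap Ps (Bmap Qs us) = us.
  move=> us_sol; apply/ffunP => i; rewrite ffunE [RHS]idE.
  rewrite [LHS]big_comp_sum; apply: eq_bigr => j _.
  rewrite -(prod_op_but_swap PsC i j us_sol).
  by rewrite [RHS](@big_comp_commute _ _ _ _ Ps (Qs j)) // => k v; rewrite [RHS]PQC.
have F_sol : set_fun (sol P f) (sol_prod Ps f) (Fmap Ps).
  by move=> u Pu i; rewrite /sol /= ffunE -[LHS](prod_op_rem PsC i) -PE.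
have B_sol : set_fun (sol_prod Ps f) (sol P f) (Bmap Qs).
  move=> us us_sol; rewrite /sol /= PE (prod_op_rem PsC ord0) /=.
  by move/ffunP/(_ ord0): (FB us us_sol); rewrite ffunE => ->; apply: us_sol.
have BF_in : {in sol P f, cancel (Fmap Ps) (Bmap Qs)} by move=> u _; apply: BF.
have FB_in : {in sol_prod Ps f, cancel (Bmap Qs) (Fmap Ps)}.
  by move=> us /set_mem; apply: FB.
split=> //.
- exact: (@can2_bij _ _ _ _ (mkfun F_sol) (mkfun B_sol)).
- exact: (@can2_bij _ _ _ _ (mkfun B_sol) (mkfun F_sol)).
Qed.
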